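(* In the edge-distinguishing game (EDGe) played on the path $P_6$ (with $\lambda(P_6)$ colors), Player 1 has a winning strategy.
   Context: $P_n$ is the path on $n$ vertices. For a positive integer $k$ let $[k]=\{1,\dots,k\}$. A $k$-coloring $c:V(G)\to[k]$ induces $c'(\{u,v\})=\{c(u),c(v)\}$ (a multiset); $c$ is edge-distinguishing if $c'$ is injective, and $\lambda(G)$ is the least $k$ admitting such a coloring. A partial coloring on $U\subseteq V(G)$ has partial induced edge coloring on $G[U]$. EDGe on $G$: two players, Player 1 first, alternately color an uncolored vertex with a color from $[\lambda(G)]$; a move is legal iff afterwards the partial induced edge coloring of the colored vertices is injective. The player making the last legal move wins. A winning strategy guarantees a win regardless of the opponent's play. *)

(* Defs.v *)
From HB Require Import structures.
From mathcomp Require Import all_boot.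

Set Implicit Arguments.
Unset Strict Implicit.
Unset Printing Implicit Defensive.

Record sgraph := SGraph {
  vertex :> finType;
  adj : rel vertex;
  adj_sym : symmetric adj;
  adj_irr : irreflexive adj
}.

Definition edges (G : sgraph) : {set {set G}} :=
  [set [set p.1; p.2] | p : G * G & adj p.1 p.2].

(* Edges of the induced subgraph G[U]. *)
Definition edges_in (G : sgraph) (U : {set G}) : {set {set G}} :=
  [set e in edges G | e \subset U].

(* The multiset of colors on the ends of an edge e, as a multiplicity
   function. *)
Definition induced (G : sgraph) (C : finType) (c : G -> C) (e : {set G}) :
  {ffun C -> nat} := [ffun a => #|[set v in e | c v == a]|].

Definition edge_distinguishing (G : sgraph) (k : nat) (c : {ffun G -> 'I_k}) :
  bool := dinjectiveb (induced c) (mem (edges G)).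

Definition ed_colorable (G : sgraph) (k : nat) : bool :=
  [exists c : {ffun G -> 'I_k}, edge_distinguishing c].

Lemma ex_ed_colorable (G : sgraph) : exists k, ed_colorable G k.
Proof.
exists #|G|; apply/existsP; exists [ffun v => enum_rank v].
apply/dinjectiveP => e1 e2 _ _ eq12; apply/setP => v.
have E (e : {set G}) :
    (v \in e) = (0 < induced [ffun w => enum_rank w] e (enum_rank v)).
  rewrite ffunE; apply/idP/card_gt0P => [ve | [w]].
    by exists v; rewrite inE ve ffunE eqxx.
  by rewrite inE ffunE => /andP[we /eqP/enum_rank_inj <-].
by rewrite !E eq12.
Qed.

Definition lambda (G : sgraph) : nat := ex_minn (ex_ed_colorable G).

(* The set U of colored vertices of a partial coloring f is where f is not
   None. *)
Definition pcoloring (G : sgraph) (k : nat) := {ffun G -> option 'I_k}.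

Definition colored (G : sgraph) (k : nat) (f : pcoloring G k) : {set G} :=
  [set v | f v != None].

(* On edges of G[U] the color None has multiplicity 0, so that induced f is
   the partial induced edge coloring. *)
Definition partial_edge_distinguishing (G : sgraph) (k : nat)
  (f : pcoloring G k) : bool :=
  dinjectiveb (induced f) (mem (edges_in (colored f))).

Definition move (G : sgraph) : Type := (G * 'I_(lambda G))%type.

Definition position (G : sgraph) := pcoloring G (lambda G).

Definition start (G : sgraph) : position G := [ffun _ => None].

Definition do_move (G : sgraph) (f : position G) (m : move G) : position G :=
  [ffun v => if v == m.1 then Some m.2 else f v].

Definition legal (G : sgraph) (f : position G) (m : move G) : bool :=
  (f m.1 == None) && partial_edge_distinguishing (do_move f m).

(* A history is the sequence of moves made so far, oldest first. Player 1 makes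
   the moves of even index, so Player 1 is to move iff its size is even, and
   made the last move iff its size is odd. *)
Definition history (G : sgraph) : Type := seq (move G).

Definition position_after (G : sgraph) (h : history G) : position G :=
  foldl (@do_move G) (start G) h.

Definition legal_history (G : sgraph) (h : history G) : Prop :=
  forall (h1 h2 : history G) (m : move G),
    h = h1 ++ m :: h2 -> legal (position_after h1) m.

Definition game_over (G : sgraph) (h : history G) : Prop :=
  forall m : move G, ~~ legal (position_after h) m.

Definition strategy (G : sgraph) : Type := history G -> move G.

Definition follows1 (G : sgraph) (s : strategy G) (h : history G) : Prop :=
  forall (h1 h2 : history G) (m : move G),
    h = h1 ++ m :: h2 -> ~~ odd (size h1) -> m = s h1.

(* The first clause makes s play legally whenever Player 1 can move; since
   every play is finite, the second one then says that Player 1 makes the last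
   legal move in every play in which Player 1 follows s. *)
Definition winning1 (G : sgraph) (s : strategy G) : Prop :=
  forall h : history G, legal_history h -> follows1 s h ->
    (~~ odd (size h) -> ~ game_over h -> legal (position_after h) (s h)) /\
    (game_over h -> odd (size h)).

Definition player1_has_winning_strategy (G : sgraph) : Prop :=
  exists s : strategy G, winning1 s.

Definition path_adj (n : nat) : rel 'I_n :=
  [rel i j : 'I_n | (i.+1 == j :> nat) || (j.+1 == i :> nat)].

Lemma path_adj_sym n : symmetric (@path_adj n).
Proof. by move=> i j; rewrite /path_adj /= orbC. Qed.

Lemma path_adj_irr n : irreflexive (@path_adj n).
Proof. by move=> i; rewrite /path_adj /= orbb gtn_eqF. Qed.

Definition path_graph (n : nat) : sgraph :=
  SGraph (@path_adj_sym n) (@path_adj_irr n).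

(* Main.v *)
Require Import Defs.
From mathcomp Require Import all_boot.

(** Six colour pairs are available with three colours and only three with two,
    so [lambda (path_graph 6) = 3]. Player 1 opens on the second vertex; against
    every reply there is a continuation after which the play stops with an odd
    number of coloured vertices. That the opening wins is a finite search, run
    on a representation of partial colourings as lists. *)

Set Implicit Arguments.
Unset Strict Implicit.
Unset Printing Implicit Defensive.

(** * Zermelo backward induction *)

Section Zermelo.

Variable G : sgraph.
Implicit Types (f : position G) (h : history G).

(** If the opponent has no legal reply, the second condition holds vacuously; this is how making the
    last move counts as a win. *)
Definition safe_move (P : pred (position G)) f (m : G * 'I_(lambda G)) : bool :=
  legal f m && [forall m' : G * 'I_(lambda G),
    legal (do_move f m) m' ==> P (do_move (do_move f m) m')].

(* The player to move can make the last move, moving at most [n] more times. *)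
Fixpoint wins_in (n : nat) f : bool :=
  if n is n'.+1 then [exists m, safe_move (wins_in n') f m] else false.

(** A strategy sees only the history, so the remaining budget is recomputed from its length: on
    Player 1's turn half of the moves are his, and the next one costs one more. [m0] is the default
    where no safe move exists. *)
Definition zermelo_strategy (N : nat) (m0 : move G) : strategy G := fun h =>
  odflt m0 [pick m | safe_move (wins_in (N - (size h)./2).-1) (position_after h) m].

Lemma position_after_rcons h m :
  position_after (rcons h m) = do_move (position_after h) m.
Proof. by rewrite /position_after foldl_rcons. Qed.

Lemma legal_history_rcons h m :
  legal_history (rcons h m) -> legal_history h /\ legal (position_after h) m.
Proof.
move=> H; split; last by apply: (H h [::] m); rewrite cats1.
by move=> h1 h2 m' E; apply: (H h1 (rcons h2 m)); rewrite E rcons_cat.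
Qed.

Lemma follows1_rcons (s : strategy G) h m :
  follows1 s (rcons h m) ->
  follows1 s h /\ (~~ odd (size h) -> m = s h).
Proof.
move=> H; split; last by apply: (H h [::] m); rewrite cats1.
by move=> h1 h2 m' E; apply: (H h1 (rcons h2 m)); rewrite E rcons_cat.
Qed.

(** [wins_in 0] is false, so the budget is positive and [pick] finds a safe move. *)
Lemma zermelo_strategyP N m0 h :
  wins_in (N - (size h)./2) (position_after h) ->
  safe_move (wins_in (N - (size h)./2).-1) (position_after h)
    (zermelo_strategy N m0 h).
Proof.
rewrite /zermelo_strategy; case: (N - _) => //= n /existsP[m sm].
by case: pickP => [//|/(_ m)]; rewrite sm.
Qed.

(** Induction on the last move: Player 1 plays a safe move, so every legal reply is winning for him;
    the opponent's move is one of these replies. *)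
Lemma zermelo_invariant N m0 h :
  wins_in N (start G) ->
  legal_history h -> follows1 (zermelo_strategy N m0) h ->
  if odd (size h) then
    forall m, legal (position_after h) m ->
      wins_in (N - (size h).+1./2) (do_move (position_after h) m)
  else wins_in (N - (size h)./2) (position_after h).
Proof.
move=> w0; elim/last_ind: h => [|h m IH]; first by rewrite subn0.
case/legal_history_rcons=> lh lm /follows1_rcons[fh mE].
move: (IH lh fh); rewrite size_rcons position_after_rcons oddS.
case: (odd (size h)) mE => [_ w|-> // w] /=; first exact: w.
move: (zermelo_strategyP m0 w); rewrite -subnS.
by case/andP=> _ /forallP H m' lm'; move/implyP: (H m'); apply.
Qed.

Lemma wins_in_winning N : wins_in N (start G) -> player1_has_winning_strategy G.
Proof.
move=> w0; have [m0 _] : exists m : G * 'I_(lambda G), true.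
  by case: N w0 => //= n /existsP[m _]; exists m.
exists (zermelo_strategy N m0) => h lh fh.
have := zermelo_invariant w0 lh fh; case odd_h: (odd (size h)) => // w.
(* On Player 1's turn the strategy supplies a legal move, so the play is not over. *)
have /andP[ls _] := zermelo_strategyP m0 w.
by split=> // over; case/negP: (over (zermelo_strategy N m0 h)).
Qed.

End Zermelo.

(** * Edge colourings of paths *)

Lemma perm_eq_map_inj (T1 T2 : eqType) (f : T1 -> T2) (s t : seq T1) :
  injective f -> perm_eq (map f s) (map f t) = perm_eq s t.
Proof. by move=> inj_f; apply/idP/idP => [/(perm_map_inj inj_f)|/(perm_map f)]. Qed.

Lemma induced_set2 (G : sgraph) (C : finType) (c : G -> C) u v a :
  u != v -> induced c [set u; v] a = count_mem a [:: c u; c v].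
Proof.
move=> uv; rewrite ffunE /= addn0 -sum1_card.
rewrite (eq_bigl (fun w => (w \in [set u; v]) && (c w == a))); last first.
  by move=> w; rewrite !inE.
by rewrite big_mkcondr big_setU1 ?inE //= big_set1; do 2!case: (_ == a).
Qed.

(** This trades multiplicity functions for two-element lists up to permutation, a condition that
    computes. *)
Lemma induced_set2_eq (G : sgraph) (C : finType) (c : G -> C) u v u' v' :
  u != v -> u' != v' ->
  (induced c [set u; v] == induced c [set u'; v']) =
  perm_eq [:: c u; c v] [:: c u'; c v'].
Proof.
move=> uv uv'; apply/eqP/idP => [E|/permP E].
  by apply/allP => a _; apply/eqP; move/ffunP/(_ a): E; rewrite !induced_set2.
by apply/ffunP => a; rewrite !induced_set2 // E.
Qed.

Section PathEdges.

Variable n : nat.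
Implicit Types i j : 'I_n.

Definition edge_fst i : path_graph n.+1 := widen_ord (leqnSn n) i.
Definition edge_snd i : path_graph n.+1 := lift ord0 i.
Definition path_edge i : {set path_graph n.+1} := [set edge_fst i; edge_snd i].

Lemma edge_ends_neq i : edge_fst i != edge_snd i.
Proof. by rewrite -val_eqE /= /bump /= add1n ltn_eqF. Qed.

Lemma edges_pathP (e : {set path_graph n.+1}) :
  reflect (exists i, e = path_edge i) (e \in edges (path_graph n.+1)).
Proof.
have key (u v : 'I_n.+1) : u.+1 = v -> exists i, [set u; v] = path_edge i.
  move=> uv; have un : u < n by rewrite -ltnS uv.
  exists (Ordinal un); congr [set _; _]; apply: val_inj => //=.
apply: (iffP imsetP) => [[[u v]]|[i ->]].
  rewrite inE => /orP[] /eqP /key[i E] -> /=; first by exists i.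
  by exists i; rewrite setUC.
exists (edge_fst i, edge_snd i) => //.
by rewrite inE /= /path_adj /= eqxx.
Qed.

Lemma path_edge_inj : injective path_edge.
Proof.
move=> i j /setP E.
have := E (edge_fst i); have := E (edge_snd i).
rewrite !inE !eqxx orbT /= -!val_eqE /= /bump /= !add1n eqSS.
(* If the second end of edge [i] were the first end of edge [j], the first end of [i] would precede
   both ends of [j]. *)
move=> /esym/orP[/eqP ij|/eqP ij _]; last exact: val_inj.
by rewrite -ij [_ == i.+1]ltn_eqF // [_ == i.+2]ltn_eqF.
Qed.

(** Serves total colourings, with [A] all edges, and partial ones, with [A] the edges inside the
    coloured set. By symmetry, comparing pairs with [j < i] suffices. *)
Lemma dinjectiveb_path (C : finType) (c : path_graph n.+1 -> C)
    (A : {set {set path_graph n.+1}}) :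
  A \subset edges (path_graph n.+1) ->
  dinjectiveb (induced c) (mem A) =
  [forall i : 'I_n, forall j : 'I_n, [&& j < i, path_edge i \in A & path_edge j \in A] ==>
    ~~ perm_eq [:: c (edge_fst i); c (edge_snd i)]
               [:: c (edge_fst j); c (edge_snd j)]].
Proof.
move=> /subsetP sA; apply/dinjectiveP/'forall_forallP.
  move=> inj i j; apply/implyP => /and3P[ji Ai Aj].
  rewrite -induced_set2_eq ?edge_ends_neq //; apply/eqP => E.
  by move: ji; rewrite (path_edge_inj (inj _ _ Ai Aj E)) ltnn.
move=> H e1 e2 A1 A2.
have [/edges_pathP[i Ei] /edges_pathP[j Ej]] := (sA _ A1, sA _ A2).
rewrite Ei Ej in A1 A2 * => E; congr path_edge; apply: val_inj.
case: (ltngtP i j) => // ij.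
  move: (H j i); rewrite ij A1 A2 -induced_set2_eq ?edge_ends_neq //.
  by rewrite -!/(path_edge _) E eqxx.
move: (H i j); rewrite ij A1 A2 -induced_set2_eq ?edge_ends_neq //.
by rewrite -!/(path_edge _) E eqxx.
Qed.

End PathEdges.

(** * Partial colourings as lists *)

Definition board := seq (option nat).

Definition board_edge (b : board) (i : nat) := [:: nth None b i; nth None b i.+1].

(* [n] counts the edges of the path, so boards have length [n.+1]. *)
Definition board_ok (n : nat) (b : board) : bool :=
  all (fun i => all (fun j =>
    all isSome (board_edge b i ++ board_edge b j) ==>
    ~~ perm_eq (board_edge b i) (board_edge b j)) (iota 0 i)) (iota 0 n).

Definition board_of n k (f : pcoloring (path_graph n.+1) k) : board :=
  [seq omap val (f v) | v <- enum 'I_n.+1].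

Section Boards.

Variables n k : nat.
Implicit Types (f : pcoloring (path_graph n.+1) k).

Lemma nth_board_of f (v : 'I_n.+1) : nth None (board_of f) v = omap val (f v).
Proof. by rewrite (nth_map v) ?size_enum_ord // nth_ord_enum. Qed.

Lemma board_edgeE f (i : 'I_n) :
  board_edge (board_of f) i =
  [seq omap val c | c <- [:: f (edge_fst i); f (edge_snd i)]].
Proof.
by rewrite /= -!nth_board_of.
Qed.

Lemma path_edge_in f (i : 'I_n) :
  (path_edge i \in edges_in (colored f)) = all isSome (board_edge (board_of f) i).
Proof.
rewrite inE (introT (edges_pathP _)); last by exists i.
rewrite board_edgeE /path_edge subUset !sub1set !inE /= andbT.
by do 2!case: (f _).
Qed.

Lemma partial_edge_distinguishing_board f :
  partial_edge_distinguishing f = board_ok n (board_of f).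
Proof.
(* Reading colours as naturals merges no two of them, nor a colour with [None]. *)
have omap_inj : injective (omap (val : 'I_k -> nat)).
  by move=> [a|] [b|] //= [/val_inj ->].
rewrite /partial_edge_distinguishing dinjectiveb_path; last first.
  by apply/subsetP => e; rewrite inE => /andP[].
apply/'forall_forallP/allP => [H i | H i j].
  rewrite mem_iota => /andP[_ ni]; apply/allP => j.
  rewrite mem_iota => /andP[_ ji].
  have nj := ltn_trans ji ni.
  move: (H (Ordinal ni) (Ordinal nj)); rewrite ji !path_edge_in.
  by rewrite all_cat -(perm_eq_map_inj _ _ omap_inj) -!board_edgeE.
apply/implyP => /and3P[ji]; rewrite !path_edge_in => Si Sj.
have /H/allP/(_ (val j)) : val i \in iota 0 n by rewrite mem_iota add0n ltn_ord.
rewrite mem_iota add0n all_cat Si Sj => /(_ ji).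
by rewrite !board_edgeE (perm_eq_map_inj _ _ omap_inj).
Qed.

End Boards.

(** * The number of colours *)

Lemma edge_distinguishing_partial n k (c : {ffun path_graph n.+1 -> 'I_k}) :
  edge_distinguishing c =
  partial_edge_distinguishing ([ffun v => Some (c v)] : pcoloring (path_graph n.+1) k).
Proof.
rewrite /edge_distinguishing /partial_edge_distinguishing.
rewrite !dinjectiveb_path //; last first.
  by apply/subsetP => e; rewrite inE => /andP[].
have colT : colored ([ffun v => Some (c v)] : pcoloring (path_graph n.+1) k) = setT.
  by apply/setP => v; rewrite !inE ffunE.
apply: eq_forallb => i; apply: eq_forallb => j.
by rewrite colT !inE !subsetT !andbT !ffunE; congr (_ ==> ~~ _).
Qed.

Lemma ed_colorable_P6 : ed_colorable (path_graph 6) 3.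
Proof.
(* The edges receive the distinct pairs 00, 01, 11, 12, 22. *)
apply/existsP; exists [ffun v : 'I_6 => inord (nth 0 [:: 0; 0; 1; 1; 2; 2] v)].
rewrite edge_distinguishing_partial partial_edge_distinguishing_board.
by rewrite /board_of !enum_ordSl enum_ord0 /= !ffunE /= !inordK.
Qed.

(* With colours 0 and 1 the sum of the colours at the ends determines the
   multiset, so the five edges would inject into {0, 1, 2}. *)
Lemma not_ed_colorable_P6 k : k <= 2 -> ~~ ed_colorable (path_graph 6) k.
Proof.
move=> k2; apply/negP => /existsP[c]; rewrite /edge_distinguishing.
rewrite dinjectiveb_path // => /'forall_forallP H.
have c1 v : c v <= 1 by rewrite -ltnS (leq_trans (ltn_ord _)).
pose s (i : 'I_5) : 'I_3 := inord (c (edge_fst i) + c (edge_snd i)).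
suff /leq_card : injective s by rewrite !card_ord.
have sE i : s i = c (edge_fst i) + c (edge_snd i) :> nat.
  by rewrite inordK // ltnS (leq_add (c1 _) (c1 _)).
have edgeT i : path_edge i \in edges (path_graph 6) by apply/edges_pathP; exists i.
have key i j : s i = s j -> ~~ (j < i).
  move=> E; apply/negP => ji; move: (H i j); rewrite ji !edgeT /= => /negP[].
  rewrite -(perm_eq_map_inj _ _ val_inj) /=.
  move: (congr1 val E); rewrite /= !sE.
  move: (c1 (edge_fst i)) (c1 (edge_snd i)) (c1 (edge_fst j)) (c1 (edge_snd j)).
  (* All four colours are 0 or 1, and in each case equal sums force equal multisets. *)
  by do 4![case: (nat_of_ord _) => [|[|?]] //].
move=> i j E; apply: val_inj; case: (ltngtP i j) => // ij.
  by case/negP: (key _ _ (esym E)).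
by case/negP: (key _ _ E).
Qed.

Lemma lambda_P6 : lambda (path_graph 6) = 3.
Proof.
rewrite /lambda; case: ex_minnP => k colk mink; apply/eqP.
rewrite eqn_leq (mink _ ed_colorable_P6) /= ltnNge.
by apply/negP => /not_ed_colorable_P6/negP.
Qed.

(** * The search *)

Definition board_play (b : board) (m : nat * nat) : board :=
  set_nth None b m.1 (Some m.2).

Definition board_legal (n : nat) (b : board) (m : nat * nat) : bool :=
  (nth None b m.1 == None) && board_ok n (board_play b m).

Fixpoint board_wins_in (n : nat) (ms : seq (nat * nat)) (r : nat) (b : board) :=
  if r is r'.+1 then
    has (fun m => let b1 := board_play b m in board_legal n b m &&
      all (fun m' => board_legal n b1 m' ==>
                     board_wins_in n ms r' (board_play b1 m')) ms) ms
  else false.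

Section Search.

Variable n : nat.
Let G := path_graph n.+1.
Implicit Types (f : position G) (m : G * 'I_(lambda G)).

Definition move_code m : nat * nat := (val m.1, val m.2).

Lemma board_of_do_move f m :
  board_of (do_move f m) = board_play (board_of f) (move_code m).
Proof.
have size_b (g : position G) : size (board_of g) = n.+1.
  by rewrite size_map size_enum_ord.
apply: (@eq_from_nth _ None) => [|i].
  (* [set_nth] could lengthen the list, but the vertex is in range. *)
  by rewrite size_set_nth !size_b (maxn_idPr (ltn_ord m.1)).
rewrite size_b => ni; rewrite nth_set_nth /=.
rewrite -[i]/(val (Ordinal ni)) !nth_board_of ffunE -val_eqE /=.
by case: (i == _).
Qed.

Lemma legal_board f m : legal f m = board_legal n (board_of f) (move_code m).
Proof.
rewrite /legal /board_legal partial_edge_distinguishing_board board_of_do_move.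
by rewrite nth_board_of; case: (f _).
Qed.

(** Only membership in [ms] is constrained, so its order is free to speed up the search. *)
Lemma board_wins_in_sound (ms : seq (nat * nat)) r f :
  (forall v a, ((v, a) \in ms) = (v < n.+1) && (a < lambda G)) ->
  board_wins_in n ms r (board_of f) -> wins_in r f.
Proof.
move=> msP; elim: r f => //= r IH f /hasP[[v a]].
rewrite msP => /andP[vn al] /andP[lm /allP A].
pose m : G * 'I_(lambda G) := (Ordinal vn, Ordinal al).
apply/existsP; exists m; rewrite /safe_move legal_board lm /=.
apply/forallP => m'; apply/implyP; rewrite legal_board board_of_do_move => lm'.
apply: IH; rewrite !board_of_do_move; apply: (implyP (A (move_code m') _)) => //.
by rewrite msP !ltn_ord.
Qed.

End Search.

(* The order of the vertices keeps the search small: Player 1 tries the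
   neighbours of the end vertices first. *)
Definition P6_moves : seq (nat * nat) :=
  [seq (v, a) | v <- [:: 1; 4; 3; 0; 2; 5], a <- iota 0 3].

Lemma mem_P6_moves v a : ((v, a) \in P6_moves) = (v < 6) && (a < 3).
Proof.
by case: v => [|[|[|[|[|[|v]]]]]]; case: a => [|[|[|a]]].
Qed.

Theorem theorem3p11 : player1_has_winning_strategy (path_graph 6).
Proof.
(* Six vertices leave Player 1 at most three moves. *)
apply: (@wins_in_winning _ 3); apply: (@board_wins_in_sound _ P6_moves).
  by move=> v a; rewrite lambda_P6 mem_P6_moves.
have -> : board_of (start (path_graph 6)) = nseq 6 None.
  by rewrite /board_of !enum_ordSl enum_ord0 /= !ffunE.
(* Lazy evaluation cuts off [has] and [all]; call by value would visit the
   whole game tree. *)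
by lazy.
Qed.
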